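(* Let $p$ be a prime. For any $r_1,r_2\in\{p^m : m\in\mathbb{Z}\}$ and any $a_1,a_2\in\mathbb{Q}_p$ the following hold. (1) The groups $(V_{r_1}(a_1),\oplus_1)$ and $(V_{r_2}(a_2),\oplus_2)$ are isomorphic. (2) The groups $(S_{r_1}(a_1),\odot_1)$ and $(S_{r_2}(a_2),\odot_2)$ are isomorphic.
   Context: $\mathbb{Q}_p$ is the field of $p$-adic numbers with the $p$-adic norm $|\cdot|_p$ normalized by $|p|_p=p^{-1}$. $V_r(a)=\{x\in\mathbb{Q}_p : |x-a|_p\le r\}$ and $S_r(a)=\{x\in\mathbb{Q}_p : |x-a|_p=r\}$. For $i=1,2$ the operations are $x\oplus_i y=x+y-a_i$ on $V_{r_i}(a_i)$ and $x\odot_i y=r_i(x-a_i)(y-a_i)+a_i$ on $S_{r_i}(a_i)$, where the rational number $r_i$ is regarded as an element of $\mathbb{Q}_p$; these are abelian group operations. *)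

(* Defs.v *)
From HB Require Import structures.
From mathcomp Require Import all_boot all_order all_algebra zify ring lra.
From mathcomp Require Import boolp classical_sets functions.

Set Implicit Arguments.
Unset Strict Implicit.
Unset Printing Implicit Defensive.

Import Order.TTheory GRing.Theory Num.Theory.
Local Open Scope ring_scope.
Local Open Scope quotient_scope.

(* |x|_p = p ^ (- v_p x) on the rationals. *)
Definition padic_abs (p : nat) (x : rat) : rat :=
  if x == 0 then 0
  else p%:R ^ ((logn p `|denq x|)%:Z - (logn p `|numq x|)%:Z).

Section PadicAbs.
Variables (p : nat) (p_pr : prime p).
Local Notation absp := (padic_abs p).

Let p_gt0 : 0 < p%:R :> rat. Proof. by rewrite ltr0n prime_gt0. Qed.
Let p_neq0 : p%:R != 0 :> rat. Proof. by rewrite gt_eqF. Qed.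
Let p_ge1 : 1 <= p%:R :> rat. Proof. by rewrite ler1n prime_gt0. Qed.

Lemma padic_abs0 : absp 0 = 0. Proof. by rewrite /padic_abs eqxx. Qed.

Lemma padic_abs_frac (a b : int) : a != 0 -> b != 0 ->
  absp (a%:Q / b%:Q) = p%:R ^ ((logn p `|b|)%:Z - (logn p `|a|)%:Z).
Proof.
move=> a0 b0; set x := a%:Q / b%:Q.
have x0 : x != 0 by rewrite mulf_neq0 ?invr_eq0 ?intr_eq0.
rewrite /padic_abs (negPf x0).
have nx0 : numq x != 0 by rewrite numq_eq0.
have E : (numq x * b = a * denq x).
  apply: (@intr_inj rat); rewrite !rmorphM /=.
  have bQ : b%:Q != 0 by rewrite intr_eq0.
  have dQ : (denq x)%:Q != 0 by rewrite intr_eq0 denq_eq0.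
  have := divq_num_den x; rewrite {3}/x => /eqP.
  by rewrite eqr_div // => /eqP.
have := congr1 (fun z : int => logn p `|z|) E; rewrite /= !abszM.
rewrite !lognM ?absz_gt0 ?denq_eq0 // => H.
by congr (_ ^ _); lia.
Qed.

Lemma padic_absM x y : absp (x * y) = absp x * absp y.
Proof.
have [->|x0] := eqVneq x 0; first by rewrite mul0r padic_abs0 mul0r.
have [->|y0] := eqVneq y 0; first by rewrite mulr0 padic_abs0 mulr0.
rewrite -{1}(divq_num_den x) -{1}(divq_num_den y) mulf_div -!intrM.
rewrite padic_abs_frac ?mulf_neq0 ?numq_eq0 ?denq_eq0 //.
rewrite [in RHS]/padic_abs (negPf x0) (negPf y0) -expfzDr // !abszM.
rewrite !lognM ?absz_gt0 ?denq_eq0 ?numq_eq0 //.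
by congr (_ ^ _); lia.
Qed.

Lemma padic_abs_ge0 x : 0 <= absp x.
Proof. by rewrite /padic_abs; case: ifP => // _; apply/exprz_ge0/ltW. Qed.

Lemma padic_abs_eq0 x : (absp x == 0) = (x == 0).
Proof.
have [->|x0] := eqVneq x 0; first by rewrite padic_abs0 eqxx.
by rewrite /padic_abs (negPf x0) expfz_eq0 (negPf p_neq0) andbF.
Qed.

Lemma padic_abs1 : absp 1 = 1.
Proof. by rewrite /padic_abs oner_eq0 subrr expr0z. Qed.

Lemma padic_absN x : absp (- x) = absp x.
Proof. by rewrite /padic_abs oppr_eq0 numqN denqN abszN. Qed.

Lemma padic_absB x y : absp (x - y) = absp (y - x).
Proof. by rewrite -padic_absN opprB. Qed.

Lemma padic_absV x : absp x^-1 = (absp x)^-1.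
Proof.
have [->|x0] := eqVneq x 0; first by rewrite !(padic_abs0, invr0).
apply: (@mulfI _ (absp x)); first by rewrite padic_abs_eq0.
by rewrite -padic_absM !divff ?padic_abs_eq0 // padic_abs1.
Qed.

Lemma padic_abs_p : absp p%:R = p%:R^-1.
Proof.
have := @padic_abs_frac (Posz p) 1 _ isT; rewrite divr1 => -> //.
  by rewrite absz1 logn1 absz_nat logn_prime // eqxx.
by rewrite eqz_nat -lt0n prime_gt0.
Qed.

Lemma padic_abs_pX (m : int) : absp (p%:R ^ m) = (p%:R ^ m)^-1.
Proof.
have natX n : absp (p%:R ^+ n) = (p%:R ^+ n)^-1.
  elim: n => [|n IHn]; first by rewrite expr0 padic_abs1 invr1.
  by rewrite exprS padic_absM IHn padic_abs_p invfM.
by case: m => n; rewrite ?NegzE -?exprnN -?exprnP ?padic_absV natX.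
Qed.

Lemma padic_abs_ultra x y : absp (x + y) <= Num.max (absp x) (absp y).
Proof.
have [->|x0] := eqVneq x 0; first by rewrite add0r le_max lexx orbT.
have [->|y0] := eqVneq y 0; first by rewrite addr0 le_max lexx.
have [->|xy0] := eqVneq (x + y) 0.
  by rewrite padic_abs0 le_max padic_abs_ge0.
have [dx0 dy0] : denq x != 0 /\ denq y != 0 by rewrite !denq_eq0.
pose d := denq x * denq y.
have d0 : d != 0 by rewrite mulf_neq0.
pose a := numq x * denq y; pose b := numq y * denq x.
have dQx : (denq x)%:Q != 0 by rewrite intr_eq0.
have dQy : (denq y)%:Q != 0 by rewrite intr_eq0.
have Ex : x = a%:Q / d%:Q.
  by rewrite -{1}(divq_num_den x) /a /d !intrM -mulf_div divff // mulr1.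
have Ey : y = b%:Q / d%:Q.
  rewrite -{1}(divq_num_den y) /b /d !intrM [(denq x)%:Q * _]mulrC.
  by rewrite -mulf_div divff // mulr1.
have Exy : x + y = (a + b)%:Q / d%:Q by rewrite intrD mulrDl -Ex -Ey.
have a0 : a != 0 by rewrite mulf_neq0 ?numq_eq0.
have b0 : b != 0 by rewrite mulf_neq0 ?numq_eq0.
have ab0 : a + b != 0.
  by move: xy0; rewrite Exy mulf_eq0 negb_or intr_eq0 => /andP[].
rewrite Exy Ex Ey !padic_abs_frac //.
have dv k : (k <= logn p `|a|)%N -> (k <= logn p `|b|)%N ->
    (k <= logn p `|(a + b)%R|)%N.
  rewrite -!pfactor_dvdn ?absz_gt0 // => ka kb.
  have : (a + b \in dvdz (p ^ k)%N) by rewrite rpredD // dvdzE.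
  by rewrite dvdzE.
rewrite le_max; apply/orP.
case: (leqP (logn p `|a|) (logn p `|b|)) => h; [left|right].
  by apply: ler_weXz2l => //; have := dv _ (leqnn _) h; lia.
by apply: ler_weXz2l => //; have := dv _ (ltnW h) (leqnn _); lia.
Qed.

Lemma padic_abs_ultra_lt x y e : absp x < e -> absp y < e -> absp (x + y) < e.
Proof.
by move=> xe ye; apply: le_lt_trans (padic_abs_ultra _ _) _; rewrite gt_max xe.
Qed.

Lemma padic_abs_dom x y : absp (x - y) < absp y -> absp x = absp y.
Proof.
move=> h; apply/eqP; rewrite eq_le; apply/andP; split.
  rewrite -{1}(subrK y x); apply: le_trans (padic_abs_ultra _ _) _.
  by rewrite ge_max lexx ltW.
have := padic_abs_ultra x (y - x).
rewrite addrC subrK le_max padic_absB => /orP[//|].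
by rewrite leNgt h.
Qed.

End PadicAbs.

(* The completion of the rationals for |.|_p: Cauchy sequences modulo null
   sequences. *)

Definition cvg_rat (u : nat -> rat) (l : rat) : Prop :=
  forall e : rat, 0 < e -> exists N, forall n, (N <= n)%N -> `|u n - l| < e.

Definition padic_cauchy (p : nat) : {pred nat -> rat} := fun u =>
  `[< forall e : rat, 0 < e -> exists N, forall m n,
      (N <= m)%N -> (N <= n)%N -> padic_abs p (u m - u n) < e >].

Definition cauchy_seq (p : nat) (p_pr : prime p) : Type :=
  {u : nat -> rat | u \in padic_cauchy p}.

Definition padic_null (p : nat) (p_pr : prime p) : {pred cauchy_seq p_pr} :=
  fun u => `[< cvg_rat (fun n => padic_abs p (sval u n)) 0 >].

Arguments padic_null {p} p_pr u : rename.

Section Completion.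
Variables (p : nat) (p_pr : prime p).
Local Notation absp := (padic_abs p).

Lemma padic_cauchyP (u : nat -> rat) :
  reflect (forall e : rat, 0 < e -> exists N, forall m n,
     (N <= m)%N -> (N <= n)%N -> absp (u m - u n) < e) (u \in padic_cauchy p).
Proof. exact: asboolP. Qed.

Lemma padic_cauchy_bounded (u : nat -> rat) : u \in padic_cauchy p ->
  exists M, 0 < M /\ exists N, forall n, (N <= n)%N -> absp (u n) < M.
Proof.
move=> /padic_cauchyP /(_ 1 ltr01)[N hN].
have aN := padic_abs_ge0 p_pr (u N).
exists (absp (u N) + 1); split; first by lra.
exists N => n Nn; rewrite -(subrK (u N) (u n)).
apply: padic_abs_ultra_lt => //; last by lra.
by apply: lt_le_trans (hN _ _ Nn (leqnn _)) _; lra.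
Qed.

Lemma padic_cauchy_subring : subring_closed (padic_cauchy p).
Proof.
split.
- apply/padic_cauchyP => e e0; exists 0%N => m n _ _.
  by rewrite subrr padic_abs0.
- move=> u v /padic_cauchyP hu /padic_cauchyP hv; apply/padic_cauchyP => e e0.
  have [N hN] := hu _ e0; have [M hM] := hv _ e0.
  exists (maxn N M) => m n; rewrite !geq_max => /andP[Nm Mm] /andP[Nn Mn].
  have -> : (u - v) m - (u - v) n = (u m - u n) + - (v m - v n).
    by rewrite !fctE; ring.
  by apply: padic_abs_ultra_lt; rewrite ?padic_absN; auto.
- move=> u v cu cv; apply/padic_cauchyP => e e0.
  have [A [A0 [N1 h1]]] := padic_cauchy_bounded cu.
  have [B [B0 [N2 h2]]] := padic_cauchy_bounded cv.
  have [N3 h3] := padic_cauchyP _ cu _ (divr_gt0 e0 B0).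
  have [N4 h4] := padic_cauchyP _ cv _ (divr_gt0 e0 A0).
  exists (maxn (maxn N1 N2) (maxn N3 N4)) => m n.
  rewrite !geq_max => /andP[/andP[m1 m2] /andP[m3 m4]].
  move=> /andP[/andP[n1 n2] /andP[n3 n4]].
  have -> : (u * v) m - (u * v) n = (u m - u n) * v m + u n * (v m - v n).
    by rewrite !fctE; ring.
  apply: padic_abs_ultra_lt => //; rewrite padic_absM //.
    rewrite -(divfK (lt0r_neq0 B0) e).
    by apply: ltr_pM; rewrite ?padic_abs_ge0 //; auto.
  rewrite -(divfK (lt0r_neq0 A0) e) mulrC.
  by apply: ltr_pM; rewrite ?padic_abs_ge0 //; auto.
Qed.

HB.instance Definition _ :=
  GRing.isSubringClosed.Build (nat -> rat) (padic_cauchy p)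
    padic_cauchy_subring.

HB.instance Definition _ := SubChoice.on (cauchy_seq p_pr).
HB.instance Definition _ :=
  [SubChoice_isSubComNzRing of cauchy_seq p_pr by <:].

Lemma padic_nullP (u : cauchy_seq p_pr) :
  reflect (forall e : rat, 0 < e -> exists N, forall n, (N <= n)%N ->
     absp (val u n) < e) (u \in padic_null p_pr).
Proof.
apply: (iffP (asboolP _)) => h e /h[N hN]; exists N => n /hN;
  by rewrite subr0 ger0_norm ?padic_abs_ge0.
Qed.

Lemma padic_null_cvg (u : cauchy_seq p_pr) : u \in padic_null p_pr ->
  cvg_rat (fun n => absp (val u n)) 0.
Proof. by move/asboolP. Qed.

Lemma padic_null_ideal : idealr_closed (padic_null p_pr).
Proof.
split.
- by apply/padic_nullP => e e0; exists 0%N => n _; rewrite padic_abs0.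
- apply/negP => /padic_nullP /(_ 1 ltr01)[N /(_ _ (leqnn N))].
  by rewrite padic_abs1 ltxx.
- move=> a u v /padic_nullP hu /padic_nullP hv; apply/padic_nullP => e e0.
  have [A [A0 [N1 h1]]] := padic_cauchy_bounded (valP a).
  have [N2 h2] := hu _ (divr_gt0 e0 A0); have [N3 h3] := hv _ e0.
  exists (maxn N1 (maxn N2 N3)) => n; rewrite !geq_max => /and3P[n1 n2 n3].
  apply: padic_abs_ultra_lt => //; last exact: h3.
  rewrite -[val (a * u) n]/(val a n * val u n) padic_absM //.
  rewrite -(divfK (lt0r_neq0 A0) e) mulrC.
  by apply: ltr_pM; rewrite ?padic_abs_ge0 //; auto.
Qed.

HB.instance Definition _ :=
  isIdealr.Build (cauchy_seq p_pr) (padic_null p_pr) padic_null_ideal.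

Definition Qp : Type := {ideal_quot (padic_null p_pr)}.

HB.instance Definition _ := GRing.ComNzRing.on Qp.
HB.instance Definition _ := NzRingQuotient.on Qp.

Definition Qp_class (u : cauchy_seq p_pr) : Qp := \pi_Qp u.

Lemma Qp_class0 : Qp_class 0 = 0. Proof. exact: pi_zeror. Qed.
Lemma Qp_class1 : Qp_class 1 = 1. Proof. exact: pi_oner. Qed.
Lemma Qp_classD u v : Qp_class (u + v) = Qp_class u + Qp_class v.
Proof. exact: pi_addr. Qed.
Lemma Qp_classN u : Qp_class (- u) = - Qp_class u.
Proof. exact: pi_oppr. Qed.
Lemma Qp_classM u v : Qp_class (u * v) = Qp_class u * Qp_class v.
Proof. exact: pi_mulr. Qed.
Lemma Qp_classK (x : Qp) : Qp_class (repr x) = x. Proof. exact: reprK. Qed.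

Lemma Qp_class_eq u v : (Qp_class u == Qp_class v) = (u - v \in padic_null p_pr).
Proof. exact/esym/Quotient.idealrBE. Qed.

Lemma Qp_class_eq0 u : (Qp_class u == 0) = (u \in padic_null p_pr).
Proof. by rewrite -Qp_class0 Qp_class_eq subr0. Qed.

Lemma padic_nonnull (u : cauchy_seq p_pr) : u \notin padic_null p_pr ->
  exists c, 0 < c /\ exists N, forall n, (N <= n)%N -> absp (val u n) = c.
Proof.
move=> nu.
have [e [e0 he]] : exists e : rat, 0 < e /\
    forall N, exists2 n, (N <= n)%N & e <= absp (val u n).
  apply: contrapT => H; move/padic_nullP: nu; apply => e e0.
  apply: contrapT => K; apply: H; exists e; split=> // N.
  apply: contrapT => L; apply: K; exists N => n Nn; rewrite ltNge.
  by apply/negP => ?; apply: L; exists n.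
have [N hN] := padic_cauchyP _ (valP u) _ e0.
have [n0 Nn0 hn0] := he N.
exists (absp (val u n0)); split; first exact: lt_le_trans hn0.
exists N => n Nn; apply: padic_abs_dom => //.
by apply: lt_le_trans hn0; exact: hN.
Qed.

Lemma Qp_inv_exists (x : Qp) : x != 0 -> exists y, y * x = 1.
Proof.
rewrite -[x]Qp_classK; set u := repr x; rewrite Qp_class_eq0 => nu.
have [c [c0 [N hN]]] := padic_nonnull nu.
pose v n := (val u n)^-1.
have cv : v \in padic_cauchy p.
  apply/padic_cauchyP => e e0.
  have [M hM] := padic_cauchyP _ (valP u) _ (mulr_gt0 e0 (mulr_gt0 c0 c0)).
  exists (maxn N M) => m n; rewrite !geq_max => /andP[Nm Mm] /andP[Nn Mn].
  have um : val u m != 0 by rewrite -(padic_abs_eq0 p_pr) hN // gt_eqF.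
  have un : val u n != 0 by rewrite -(padic_abs_eq0 p_pr) hN // gt_eqF.
  have -> : v m - v n = (val u n - val u m) / (val u m * val u n).
    by rewrite /v; field; rewrite um un.
  rewrite !(padic_absM, padic_absV) // !hN // ltr_pdivrMr ?mulr_gt0 //.
  exact: hM.
exists (Qp_class (exist _ v cv : cauchy_seq p_pr)).
rewrite -Qp_class1 -Qp_classM.
apply/eqP; rewrite Qp_class_eq; apply/padic_nullP => e e0.
exists N => n Nn.
have un : val u n != 0 by rewrite -(padic_abs_eq0 p_pr) hN // gt_eqF.
by rewrite -[val _ n]/(v n * val u n - 1) /v mulVf // subrr padic_abs0.
Qed.

Definition Qp_inv (x : Qp) : Qp := xget 0 [set y | y * x = 1]%classic.

Lemma Qp_mulVf (x : Qp) : x != 0 -> Qp_inv x * x = 1.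
Proof. by move=> /Qp_inv_exists; exact: xgetPex. Qed.

Lemma Qp_invr0 : Qp_inv 0 = 0.
Proof.
by apply: xgetPN => y /= /eqP; rewrite mulr0 eq_sym oner_eq0.
Qed.

HB.instance Definition _ := GRing.ComNzRing_isField.Build Qp Qp_mulVf Qp_invr0.

(* The norm extends by continuity; its values lie in p^Z and 0, hence in rat. *)
Definition Qp_norm (x : Qp) : rat :=
  xget 0 [set l | cvg_rat (fun n => absp (val (repr x) n)) l]%classic.

Fact cauchy_cst_subproof (q : rat) : (fun=> q) \in padic_cauchy p.
Proof.
by apply/padic_cauchyP => e e0; exists 0%N => m n _ _; rewrite subrr padic_abs0.
Qed.

Definition Qp_of_rat (q : rat) : Qp :=
  Qp_class (exist _ (fun=> q) (cauchy_cst_subproof q) : cauchy_seq p_pr).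

Lemma cvg_rat_unique (u : nat -> rat) l l' :
  cvg_rat u l -> cvg_rat u l' -> l = l'.
Proof.
move=> h h'; apply/eqP; rewrite -subr_eq0 -normr_le0 leNgt; apply/negP => d0.
have d2 : 0 < `|l - l'| / 2 by rewrite divr_gt0.
have [N hN] := h _ d2; have [M hM] := h' _ d2.
have := hN _ (leq_maxl N M); have := hM _ (leq_maxr N M).
set a := u _ => A B; have := ler_distD a l l'.
rewrite (distrC l a); lra.
Qed.

Lemma cvg_rat_eventually (u : nat -> rat) c :
  (exists N, forall n, (N <= n)%N -> u n = c) -> cvg_rat u c.
Proof.
by move=> [N hN] e e0; exists N => n /hN ->; rewrite subrr normr0.
Qed.

Lemma cvg_rat_cauchy (u : cauchy_seq p_pr) :
  exists l, cvg_rat (fun n => absp (val u n)) l.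
Proof.
have [/asboolP nu|/padic_nonnull[c [_ hc]]] := boolP (u \in padic_null p_pr).
  by exists 0.
by exists c; apply: cvg_rat_eventually.
Qed.

Lemma Qp_norm_pi (u : cauchy_seq p_pr) :
  cvg_rat (fun n => absp (val u n)) (Qp_norm (Qp_class u)).
Proof.
set w := repr (Qp_class u).
have cw : cvg_rat (fun n => absp (val w n)) (Qp_norm (Qp_class u)).
  by have /(@xgetPex _ 0) := cvg_rat_cauchy w.
have uw : u - w \in padic_null p_pr by rewrite -Qp_class_eq Qp_classK.
have [nw|nw] := boolP (w \in padic_null p_pr).
  have nu : u \in padic_null p_pr by rewrite -(subrK w u) rpredD.
  by rewrite (cvg_rat_unique cw (padic_null_cvg nw)); exact: padic_null_cvg.
have [c [c0 hc]] := padic_nonnull nw.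
rewrite (cvg_rat_unique cw (cvg_rat_eventually hc)).
apply: cvg_rat_eventually.
have [N hN] := hc; have [M hM] := padic_nullP _ uw _ c0.
exists (maxn N M) => n; rewrite geq_max => /andP[Nn Mn].
rewrite -(hN n Nn); apply: padic_abs_dom => //; rewrite hN //.
exact: hM.
Qed.

Lemma Qp_normP (u : cauchy_seq p_pr) l :
  cvg_rat (fun n => absp (val u n)) l -> Qp_norm (Qp_class u) = l.
Proof. exact/cvg_rat_unique/Qp_norm_pi. Qed.

Lemma Qp_norm_cases (x : Qp) : x = 0 /\ Qp_norm x = 0 \/
  exists u : cauchy_seq p_pr, x = Qp_class u /\ 0 < Qp_norm x /\
    exists N, forall n, (N <= n)%N -> absp (val u n) = Qp_norm x.
Proof.
rewrite -[x]Qp_classK; set u := repr x.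
have [nu|nu] := boolP (u \in padic_null p_pr); [left|right].
  by split; [apply/eqP; rewrite Qp_class_eq0|exact/Qp_normP/padic_null_cvg].
have [c [c0 hc]] := padic_nonnull nu.
by exists u; rewrite (Qp_normP (cvg_rat_eventually hc)).
Qed.

Lemma Qp_norm_of_rat (q : rat) : Qp_norm (Qp_of_rat q) = absp q.
Proof. by apply: Qp_normP; apply: cvg_rat_eventually; exists 0%N. Qed.

Lemma Qp_norm0 : Qp_norm 0 = 0.
Proof.
rewrite -Qp_class0; apply: Qp_normP; apply: cvg_rat_eventually.
by exists 0%N => n _; rewrite padic_abs0.
Qed.

Lemma Qp_norm_ge0 x : 0 <= Qp_norm x.
Proof. by have [[_ ->]|[u [_ [/ltW]]]] := Qp_norm_cases x. Qed.

Lemma Qp_norm_eq0 x : (Qp_norm x == 0) = (x == 0).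
Proof.
have [[-> ->]|[u [_ [x0 _]]]] := Qp_norm_cases x; first by rewrite !eqxx.
rewrite gt_eqF //; apply/esym/eqP => xE; move: x0.
by rewrite xE Qp_norm0 ltxx.
Qed.

Lemma Qp_normM x y : Qp_norm (x * y) = Qp_norm x * Qp_norm y.
Proof.
have [[-> ->]|[u [xE [_ [N hN]]]]] := Qp_norm_cases x.
  by rewrite !mul0r Qp_norm0.
have [[-> ->]|[v [yE [_ [M hM]]]]] := Qp_norm_cases y.
  by rewrite !mulr0 Qp_norm0.
rewrite [in LHS]xE [in LHS]yE -Qp_classM; apply: Qp_normP.
apply: cvg_rat_eventually; exists (maxn N M) => n.
rewrite geq_max => /andP[Nn Mn].
by rewrite -[val _ n]/(val u n * val v n) padic_absM // hN // hM.
Qed.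

Lemma Qp_norm_ultra x y : Qp_norm (x + y) <= Num.max (Qp_norm x) (Qp_norm y).
Proof.
have [[-> ->]|[u [xE [_ [N hN]]]]] := Qp_norm_cases x.
  by rewrite add0r le_max lexx orbT.
have [[-> ->]|[v [yE [_ [M hM]]]]] := Qp_norm_cases y.
  by rewrite addr0 le_max lexx.
rewrite [in leLHS]xE [in leLHS]yE -Qp_classD; have h := Qp_norm_pi (u + v).
rewrite leNgt; apply/negP; rewrite -subr_gt0 => /h[K hK].
pose n := maxn K (maxn N M).
have := hK n (leq_maxl _ _).
have := padic_abs_ultra p_pr (val u n) (val v n).
rewrite hN ?hM ?leq_max ?leqnn ?orbT //.
rewrite -[val (u + v) n]/(val u n + val v n).
set c := Num.max _ _; set l := Qp_norm _; set d := absp _ => dc.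
rewrite ltr_norml => /andP[+ _]; lra.
Qed.

Lemma Qp_norm_opp x : Qp_norm (- x) = Qp_norm x.
Proof.
have n1 : Qp_norm (- 1) = 1.
  rewrite -Qp_class1 -Qp_classN; apply: Qp_normP; apply: cvg_rat_eventually.
  by exists 0%N => n _; rewrite -[val _ n]/(- 1) padic_absN padic_abs1.
by rewrite -mulN1r Qp_normM n1 mul1r.
Qed.

Lemma Qp_norm1 : Qp_norm 1 = 1.
Proof.
rewrite -Qp_class1; apply: Qp_normP; apply: cvg_rat_eventually.
by exists 0%N => n _; rewrite -[val _ n]/1 padic_abs1.
Qed.

Lemma Qp_normV x : Qp_norm x^-1 = (Qp_norm x)^-1.
Proof.
have [->|x0] := eqVneq x 0; first by rewrite !(invr0, Qp_norm0).
apply: (@mulfI _ (Qp_norm x)); first by rewrite Qp_norm_eq0.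
by rewrite -Qp_normM !divff ?Qp_norm_eq0 // Qp_norm1.
Qed.

End Completion.

Definition is_radius (p : nat) : {pred rat} :=
  fun r => `[< exists m : int, r = p%:R ^ m >].

Definition radius (p : nat) : Type := {r : rat | r \in is_radius p}.

Section BallsAndSpheres.
Variables (p : nat) (p_pr : prime p) (r : radius p) (a : Qp p_pr).
Local Notation norm := (@Qp_norm p p_pr).
Local Notation rQ := (sval r).
Local Notation rQp := (Qp_of_rat p_pr (sval r)).

(* V_r(a), as a carrier for x + y - a. *)
Definition padic_ball : Type := {x : Qp p_pr | norm (x - a) <= rQ}.
(* S_r(a), as a carrier for r (x - a) (y - a) + a; the factor r is the image of
   the rational r in Qp. *)
Definition padic_sphere : Type := {x : Qp p_pr | norm (x - a) == rQ}.

HB.instance Definition _ := SubChoice.on padic_ball.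
HB.instance Definition _ := SubChoice.on padic_sphere.

Fact radius_gt0 : 0 < rQ.
Proof.
by have /asboolP[m ->] := svalP r; rewrite exprz_gt0 // ltr0n prime_gt0.
Qed.

Fact Qp_norm_radius : norm rQp = rQ^-1.
Proof.
rewrite Qp_norm_of_rat; have /asboolP[m ->] := svalP r.
exact: padic_abs_pX.
Qed.

Fact Qp_radius_neq0 : rQp != 0.
Proof. by rewrite -Qp_norm_eq0 Qp_norm_radius invr_eq0 gt_eqF // radius_gt0. Qed.

Let rN0 : rQ != 0. Proof. by rewrite gt_eqF // radius_gt0. Qed.

Fact ball_add_subproof (x y : padic_ball) : norm (val x + val y - a - a) <= rQ.
Proof.
have -> : val x + val y - a - a = (val x - a) + (val y - a) by ring.
apply: le_trans (Qp_norm_ultra _ _) _.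
by rewrite ge_max (valP x) (valP y).
Qed.

Fact ball_zero_subproof : norm (a - a) <= rQ.
Proof. by rewrite subrr Qp_norm0 ltW // radius_gt0. Qed.

Fact ball_opp_subproof (x : padic_ball) : norm (a *+ 2 - val x - a) <= rQ.
Proof.
have -> : a *+ 2 - val x - a = - (val x - a) by ring.
by rewrite Qp_norm_opp (valP x).
Qed.

Definition ball_add (x y : padic_ball) : padic_ball :=
  exist _ (val x + val y - a) (ball_add_subproof x y).
Definition ball_zero : padic_ball := exist _ a ball_zero_subproof.
Definition ball_opp (x : padic_ball) : padic_ball :=
  exist _ (a *+ 2 - val x) (ball_opp_subproof x).

Fact ball_addA : associative ball_add.
Proof. by move=> x y z; apply: val_inj => /=; ring. Qed.
Fact ball_addC : commutative ball_add.
Proof. by move=> x y; apply: val_inj => /=; ring. Qed.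
Fact ball_add0x : left_id ball_zero ball_add.
Proof. by move=> x; apply: val_inj => /=; ring. Qed.
Fact ball_addx0 : right_id ball_zero ball_add.
Proof. by move=> x; rewrite ball_addC ball_add0x. Qed.
Fact ball_addNx : left_inverse ball_zero ball_opp ball_add.
Proof. by move=> x; apply: val_inj => /=; ring. Qed.
Fact ball_addxN : right_inverse ball_zero ball_opp ball_add.
Proof. by move=> x; rewrite ball_addC ball_addNx. Qed.

HB.instance Definition _ := isGroup.Build padic_ball
  ball_addA ball_add0x ball_addx0 ball_addNx ball_addxN.

Fact sphere_mul_subproof (x y : padic_sphere) :
  norm (rQp * (val x - a) * (val y - a) + a - a) == rQ.
Proof.
rewrite addrK !Qp_normM Qp_norm_radius (eqP (valP x)) (eqP (valP y)).
by rewrite mulVf // mul1r.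
Qed.

Fact sphere_one_subproof : norm (rQp^-1 + a - a) == rQ.
Proof. by rewrite addrK Qp_normV Qp_norm_radius invrK. Qed.

Fact sphere_inv_subproof (x : padic_sphere) :
  norm ((rQp ^+ 2 * (val x - a))^-1 + a - a) == rQ.
Proof.
rewrite addrK Qp_normV expr2 !Qp_normM Qp_norm_radius (eqP (valP x)).
by rewrite mulfVK // invrK.
Qed.

Definition sphere_mul (x y : padic_sphere) : padic_sphere :=
  exist _ (rQp * (val x - a) * (val y - a) + a) (sphere_mul_subproof x y).
Definition sphere_one : padic_sphere := exist _ (rQp^-1 + a) sphere_one_subproof.
Definition sphere_inv (x : padic_sphere) : padic_sphere :=
  exist _ ((rQp ^+ 2 * (val x - a))^-1 + a) (sphere_inv_subproof x).

Fact sphere_mulA : associative sphere_mul.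
Proof. by move=> x y z; apply: val_inj => /=; ring. Qed.
Fact sphere_mulC : commutative sphere_mul.
Proof. by move=> x y; apply: val_inj => /=; ring. Qed.
Fact sphere_mul1x : left_id sphere_one sphere_mul.
Proof.
move=> x; apply: val_inj => /=; rewrite addrK divff ?Qp_radius_neq0 //.
by rewrite mul1r subrK.
Qed.
Fact sphere_mulx1 : right_id sphere_one sphere_mul.
Proof. by move=> x; rewrite sphere_mulC sphere_mul1x. Qed.
Fact sphere_mulVx : left_inverse sphere_one sphere_inv sphere_mul.
Proof.
move=> x; apply: val_inj => /=; rewrite addrK.
have x0 : val x - a != 0 by rewrite -Qp_norm_eq0 (eqP (valP x)).
by rewrite invfM expr2 invfM mulrA mulVKf ?Qp_radius_neq0 // mulfVK.
Qed.
Fact sphere_mulxV : right_inverse sphere_one sphere_inv sphere_mul.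
Proof. by move=> x; rewrite sphere_mulC sphere_mulVx. Qed.

HB.instance Definition _ := isGroup.Build padic_sphere
  sphere_mulA sphere_mul1x sphere_mulx1 sphere_mulVx sphere_mulxV.

End BallsAndSpheres.

Definition group_isomorphic (G H : groupType) : Prop :=
  exists f : {multiplicative G -> H}, bijective f.

(* Main.v *)
Require Import Defs.
From mathcomp Require Import all_boot all_order all_algebra.
From HB Require Import structures.
From mathcomp Require Import ring.

Set Implicit Arguments.
Unset Strict Implicit.
Unset Printing Implicit Defensive.

Import Order.TTheory GRing.Theory Num.Theory.
Local Open Scope ring_scope.

(** One affine similarity proves both parts. A radius [r], a power of [p],
    becomes in the p-adic field an element of norm [r^-1], so the quotient
    [r1 / r2] of two radii has p-adic norm [r2 / r1]. Hence
    [x |-> (r1 / r2) (x - a1) + a2] carries the ball and the sphere of radius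
    [r1] about [a1] into those of radius [r2] about [a2]
    ([Qp_norm_recenter]); its inverse is the similarity that exchanges the two
    centers and radii ([similarityK]).

    Measured from the center, the ball law is ordinary addition, so every
    homothety respects it ([similarity_ball_law]). The sphere law is
    multiplication twisted by the factor [r], which becomes multiplication of
    units in the normalized coordinate [r (x - a)]. The similarity leaves this
    coordinate unchanged, since [r2 (r1 / r2) = r1]; so the same scaling factor,
    chosen above for its norm, also intertwines the two twisted products
    ([similarity_sphere_law]). *)

Definition similarity (F : fieldType) (s1 s2 a1 a2 x : F) : F :=
  s1 / s2 * (x - a1) + a2.

Lemma similarityK (F : fieldType) (s1 s2 a1 a2 : F) :
  s1 != 0 -> s2 != 0 ->
  cancel (similarity s1 s2 a1 a2) (similarity s2 s1 a2 a1).
Proof. by move=> s1N0 s2N0 x; rewrite /similarity; field; rewrite s1N0 s2N0. Qed.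

Lemma similarity_ball_law (F : fieldType) (s1 s2 a1 a2 x y : F) :
  similarity s1 s2 a1 a2 (x + y - a1) =
  similarity s1 s2 a1 a2 x + similarity s1 s2 a1 a2 y - a2.
Proof. by rewrite /similarity; ring. Qed.

(** Both sides have [s1 ^+ 2 / s2] in front of the product of the two
    displacements: the source law contributes one factor [s1] and the
    similarity [s1 / s2]; in the target the similarity contributes its square
    and the law one factor [s2]. *)
Lemma similarity_sphere_law (F : fieldType) (s1 s2 a1 a2 x y : F) :
  s2 != 0 ->
  similarity s1 s2 a1 a2 (s1 * (x - a1) * (y - a1) + a1) =
  s2 * (similarity s1 s2 a1 a2 x - a2) * (similarity s1 s2 a1 a2 y - a2) + a2.
Proof. by move=> s2N0; rewrite /similarity; field. Qed.

Section Recenter.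
Variables (p : nat) (p_pr : prime p).
Local Notation Q := (Qp p_pr).
Local Notation norm := (@Qp_norm p p_pr).

Definition recenter (r1 r2 : radius p) : Q -> Q -> Q -> Q :=
  similarity (Qp_of_rat p_pr (sval r1)) (Qp_of_rat p_pr (sval r2)).

Lemma recenterK r1 r2 a1 a2 :
  cancel (recenter r1 r2 a1 a2) (recenter r2 r1 a2 a1).
Proof. by apply: similarityK; exact: Qp_radius_neq0. Qed.

(** The p-adic size of a power of [p] is inverse to its rational size, which is
    why [r1] stands over [r2] in the scaling factor, not the reverse. *)
Lemma Qp_norm_recenter r1 r2 a1 a2 x :
  norm (recenter r1 r2 a1 a2 x - a2) = sval r2 / sval r1 * norm (x - a1).
Proof.
by rewrite /recenter /similarity addrK !Qp_normM Qp_normV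
   !Qp_norm_radius invrK [_^-1 * _]mulrC.
Qed.

Lemma recenter_ball_subproof r1 r2 a1 a2 (x : padic_ball r1 a1) :
  norm (recenter r1 r2 a1 a2 (val x) - a2) <= sval r2.
Proof.
rewrite Qp_norm_recenter mulrAC ler_pdivrMr ?radius_gt0 //.
by apply: ler_wpM2l (valP x); exact/ltW/radius_gt0.
Qed.

Lemma recenter_sphere_subproof r1 r2 a1 a2 (x : padic_sphere r1 a1) :
  norm (recenter r1 r2 a1 a2 (val x) - a2) == sval r2.
Proof.
by rewrite Qp_norm_recenter (eqP (valP x)) divfK // gt_eqF // radius_gt0.
Qed.

Definition recenter_ball r1 r2 a1 a2 (x : padic_ball r1 a1) :
  padic_ball r2 a2 :=
  exist _ (recenter r1 r2 a1 a2 (val x)) (recenter_ball_subproof r2 a2 x).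

Definition recenter_sphere r1 r2 a1 a2 (x : padic_sphere r1 a1) :
  padic_sphere r2 a2 :=
  exist _ (recenter r1 r2 a1 a2 (val x)) (recenter_sphere_subproof r2 a2 x).

Lemma recenter_ballM r1 r2 a1 a2 :
  {morph @recenter_ball r1 r2 a1 a2 : x y / (x * y)%g}.
Proof. by move=> x y; apply: val_inj; exact: similarity_ball_law. Qed.

Lemma recenter_sphereM r1 r2 a1 a2 :
  {morph @recenter_sphere r1 r2 a1 a2 : x y / (x * y)%g}.
Proof.
move=> x y; apply: val_inj.
exact/similarity_sphere_law/Qp_radius_neq0.
Qed.

HB.instance Definition _ r1 r2 a1 a2 :=
  isMultiplicative.Build _ _ _ (@recenter_ballM r1 r2 a1 a2).

HB.instance Definition _ r1 r2 a1 a2 :=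
  isMultiplicative.Build _ _ _ (@recenter_sphereM r1 r2 a1 a2).

Lemma recenter_ballK r1 r2 a1 a2 :
  cancel (@recenter_ball r1 r2 a1 a2) (@recenter_ball r2 r1 a2 a1).
Proof. by move=> x; apply: val_inj; exact: recenterK. Qed.

Lemma recenter_sphereK r1 r2 a1 a2 :
  cancel (@recenter_sphere r1 r2 a1 a2) (@recenter_sphere r2 r1 a2 a1).
Proof. by move=> x; apply: val_inj; exact: recenterK. Qed.

End Recenter.

Theorem theorem2 (p : nat) (p_pr : prime p) (r1 r2 : radius p)
    (a1 a2 : Qp p_pr) :
  group_isomorphic (padic_ball r1 a1) (padic_ball r2 a2) /\
  group_isomorphic (padic_sphere r1 a1) (padic_sphere r2 a2).
Proof.
split.
  exists (@recenter_ball _ p_pr r1 r2 a1 a2).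
  by exists (@recenter_ball _ p_pr r2 r1 a2 a1); exact: recenter_ballK.
exists (@recenter_sphere _ p_pr r1 r2 a1 a2).
by exists (@recenter_sphere _ p_pr r2 r1 a2 a1); exact: recenter_sphereK.
Qed.
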